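(* Let $k\ge 2$ be an integer, let $Q$ be an integer with $2Q-1\ge k$, let $L=\lceil \frac{k+3}{2}\rceil$ and $\widehat\omega_1=\frac{1}{L(L-1)}$. Let $\widetilde{\mathbf U}_h\in\mathbb G_h^k$, and for each cell $K$ let $\overline{\mathbf U}_K$ be the cell average of $\widetilde{\mathbf U}_h$ over $K$. Let $\mathbf L_K$ be the finite volume spatial operator with the HLL flux, $$\mathbf L_K(\widetilde{\mathbf U}_h)=-\frac{1}{|K|}\sum_{j=1}^3|\mathcal E_K^j|\sum_{q=1}^Q\omega_q\,\widehat{\mathbf F}^{hll}\big(\widetilde{\mathbf U}^{\mathrm{int}(K)}_{jq},\widetilde{\mathbf U}^{\mathrm{ext}(K)}_{jq};\mathbf n_K^{(j)}\big).$$ Let $\Delta t>0$ satisfy the CFL condition $$\Delta t\,\widehat\sigma_K^{(j)}\,\frac{|\mathcal E_K^j|}{|K|}\le\frac23\widehat\omega_1\qquad\text{for all } K\in\mathcal T_h,\ j\in\{1,2,3\},$$ where $$\widehat\sigma_K^{(j)}:=\max\big\{\widehat\sigma(\mathbf U;\mathbf n_K^{(j)}):\ \mathbf U\in\{\widetilde{\mathbf U}^{\mathrm{int}(K)}_{jq},\widetilde{\mathbf U}^{\mathrm{ext}(K)}_{jq}\},\ 1\le q\le Q\big\}.$$ Then $$\overline{\mathbf U}_K+\Delta t\,\mathbf L_K(\widetilde{\mathbf U}_h)\in G_u\qquad\text{for all }K\in\mathcal T_h.$$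
   Context: **Relativistic hydrodynamics (RHD) variables.** Fix $\Gamma\in(1,2]$. $\|\cdot\|$ is the Euclidean norm on $\mathbb R^2$. Primitive vectors are $\mathbf W=(\rho,\boldsymbol v,p)^\top\in\mathbb R^4$ with $\boldsymbol v=(v_1,v_2)$, and $G_w=\{\mathbf W:\rho>0,\ p>0,\ \|\boldsymbol v\|<1\}$. Put $\gamma=(1-\|\boldsymbol v\|^2)^{-1/2}$ and $H=1+\frac{\Gamma}{\Gamma-1}\frac p\rho$. The conservative vector $\mathbf U=(D,\boldsymbol m,E)^\top\in\mathbb R^4$, $\boldsymbol m\in\mathbb R^2$, associated with $\mathbf W$ is $D=\rho\gamma$, $\boldsymbol m=\rho H\gamma^2\boldsymbol v$, $E=\rho H\gamma^2-p$. Given $\mathbf U$, $p(\mathbf U)$ is the solution $p\in[0,\infty)$ of $$\Phi_{\mathbf U}(p):=\frac{p}{\Gamma-1}-E+\frac{\|\boldsymbol m\|^2}{E+p}+D\sqrt{1-\frac{\|\boldsymbol m\|^2}{(E+p)^2}}=0,$$ and $\boldsymbol v(\mathbf U)=\boldsymbol m/(E+p(\mathbf U))$, $\rho(\mathbf U)=D\sqrt{1-\|\boldsymbol v(\mathbf U)\|^2}$. The admissible set is $G_u=\{\mathbf U\in\mathbb R^4:\rho(\mathbf U)>0,\ p(\mathbf U)>0,\ \|\boldsymbol v(\mathbf U)\|<1\}$. It is a known fact that $G_u=\{\mathbf U: D>0,\ E-\sqrt{D^2+\|\boldsymbol m\|^2}>0\}$ and that $G_u$ is convex. For $\mathbf U\in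 G_u$, the quantities $\rho,\boldsymbol v,p,\gamma,H$ are the ones recovered from $\mathbf U$. **Fluxes and wave speeds.** For $\mathbf U\in G_u$: $\mathbf F_1(\mathbf U)=(Dv_1,m_1v_1+p,m_2v_1,m_1)^\top$, $\mathbf F_2(\mathbf U)=(Dv_2,m_1v_2,m_2v_2+p,m_2)^\top$; for a unit vector $\mathbf n=(n_1,n_2)$, $\mathbf n\cdot\mathbf F(\mathbf U)=n_1\mathbf F_1(\mathbf U)+n_2\mathbf F_2(\mathbf U)$. Let $c_s=\sqrt{\Gamma p/(\rho H)}$, $v_{\mathbf n}=v_1n_1+v_2n_2$, and $$\lambda^{(1)}_{\mathbf n},\lambda^{(4)}_{\mathbf n}=\frac{v_{\mathbf n}(1-c_s^2)\mp c_s\gamma^{-1}\sqrt{1-v_{\mathbf n}^2-(\|\boldsymbol v\|^2-v_{\mathbf n}^2)c_s^2}}{1-\|\boldsymbol v\|^2c_s^2}$$ (minus sign for $\lambda^{(1)}_{\mathbf n}$, plus sign for $\lambda^{(4)}_{\mathbf n}$), and $$\widehat\sigma(\mathbf U;\mathbf n)=\frac{|v_{\mathbf n}|(1-c_s^2)+c_s\gamma^{-1}\sqrt{1-v_{\mathbf n}^2-(\|\boldsymbol v\|^2-v_{\mathbf n}^2)c_s^2}}{1-\|\boldsymbol v\|^2c_s^2}.$$ **HLL flux.** For $\mathbf U^\pm\in G_u$ let $\sigma_l=\min\{\lambda^{(1)}_{\mathbf n}(\mathbf U^-),\lambda^{(1)}_{\mathbf n}(\mathbf U^+),0\}$, $\sigma_r=\max\{\lambda^{(4)}_{\mathbf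 n}(\mathbf U^-),\lambda^{(4)}_{\mathbf n}(\mathbf U^+),0\}$, and $$\widehat{\mathbf F}^{hll}(\mathbf U^-,\mathbf U^+;\mathbf n)=\frac{\sigma_r\,\mathbf n\cdot\mathbf F(\mathbf U^-)-\sigma_l\,\mathbf n\cdot\mathbf F(\mathbf U^+)+\sigma_l\sigma_r(\mathbf U^+-\mathbf U^-)}{\sigma_r-\sigma_l}.$$ **Mesh and discrete spaces.** $\mathcal T_h$ is a conforming triangulation of a 2D domain; every edge of every cell is regarded as shared with a neighbouring cell (e.g. periodic identification). For $K\in\mathcal T_h$, $|K|$ is its area, $\mathcal E_K^j$ ($j=1,2,3$) its edges with lengths $|\mathcal E_K^j|$ and unit outward normals $\mathbf n_K^{(j)}$; $\{\boldsymbol x_K^{(jq)}\}_{q=1}^Q$ are the $Q$-point Gauss quadrature points on $\mathcal E_K^j$ with (positive) weights $\omega_q$ normalized by $\sum_q\omega_q=1$. $\mathbb V_h^k$ is the space of $\mathbb R^4$-valued functions whose restriction to each $K$ has polynomial components of total degree at most $k$. For $\mathbf u\in\mathbb V_h^k$, $\overline{\mathbf u}_K=\frac1{|K|}\iint_K\mathbf u\,d\boldsymbol x$ and $\mathbf u_K^{(jq)}=\mathbf u|_K(\boldsymbol x_K^{(jq)})$. $\mathbb G_h^k$ is the set of $\mathbf u\in\mathbb V_h^k$ such that for all $K\in\mathcal T_h$: $\overline{\mathbf u}_K\in G_u$; $\mathbf u_K^{(jq)}\in G_u$ for all $1\le j\le3$, $1\le q\le Q$; and $$\frac{\overline{\mathbf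 u}_K-\frac23\widehat\omega_1\sum_{j=1}^3\sum_{q=1}^Q\omega_q\mathbf u_K^{(jq)}}{1-2\widehat\omega_1}\in G_u.$$ $\widetilde{\mathbf U}^{\mathrm{int}(K)}_{jq}$ and $\widetilde{\mathbf U}^{\mathrm{ext}(K)}_{jq}$ are the limits of $\widetilde{\mathbf U}_h$ at $\boldsymbol x_K^{(jq)}$ from inside $K$ and from the neighbouring cell across $\mathcal E_K^j$, respectively (so both belong to $G_u$ when $\widetilde{\mathbf U}_h\in\mathbb G_h^k$). *)

(* Defs.v *)
(* MathComp-Analysis, over an arbitrary R : realType.
   Vectors of the physical plane are pairs R * R.  The norm `|x| that the
   library puts on R * R is the sup norm, so the Euclidean inner product and
   norm are defined below. *)
From HB Require Import structures.
From mathcomp Require Import all_boot all_order all_algebra.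
From mathcomp Require Import all_classical all_reals all_analysis.
Set Implicit Arguments.
Unset Strict Implicit.
Unset Printing Implicit Defensive.
Import Order.TTheory GRing.Theory Num.Theory numFieldNormedType.Exports.
Local Open Scope classical_set_scope.
Local Open Scope ring_scope.

Section Plane.
Variable R : realType.
Implicit Types x y : R * R.

Definition dot x y : R := x.1 * y.1 + x.2 * y.2.
Definition enorm x : R := Num.sqrt (dot x x).

Definition mu2 := (@lebesgue_measure R \x @lebesgue_measure R)%E.

Definition segment x y : set (R * R) :=
  [set z | exists2 t : R, 0 <= t <= 1 & z = (1 - t) *: x + t *: y].

Definition triangle (a : 'I_3 -> R * R) : set (R * R) :=
  [set z | exists c : 'I_3 -> R,
    [/\ forall i, 0 <= c i, \sum_i c i = 1 & z = \sum_i c i *: a i]].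

End Plane.

Section RHD.
Variables (R : realType) (Gam : R).
Implicit Types U : 'rV[R]_4.

Definition vec4 (a b c d : R) : 'rV[R]_4 := \row_i [:: a; b; c; d]`_i.

(* U = (D, m1, m2, E) *)
Definition cD U : R := U 0 0.
Definition cm U : R * R := (U 0 1, U 0 2%:R).
Definition cE U : R := U 0 3%:R.

Definition Phi U (p : R) : R :=
  p / (Gam - 1) - cE U + enorm (cm U) ^+ 2 / (cE U + p)
  + cD U * Num.sqrt (1 - enorm (cm U) ^+ 2 / (cE U + p) ^+ 2).

(* xget picks an element of the given set, and returns 0 when it is empty: a U
   for which Phi_U has no root is then excluded from Gu by 0 < pressure U.
   The conventions y / 0 = 0 and sqrt y = 0 for y < 0 add no state to Gu: if
   0 < p, 0 < rho and the Euclidean norm of the velocity is < 1, then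
   Phi_U(p) = 0 forces 0 < cE U + p. *)
Definition pressure U : R := xget 0 [set p | 0 <= p /\ Phi U p = 0].
Definition velocity U : R * R := (cE U + pressure U)^-1 *: cm U.
Definition density U : R := cD U * Num.sqrt (1 - enorm (velocity U) ^+ 2).

Definition Gu : set 'rV[R]_4 :=
  [set U | [/\ 0 < density U, 0 < pressure U & enorm (velocity U) < 1]].

Definition lorentz U : R := (Num.sqrt (1 - enorm (velocity U) ^+ 2))^-1.
Definition enthalpy U : R := 1 + Gam / (Gam - 1) * (pressure U / density U).
Definition sound U : R :=
  Num.sqrt (Gam * pressure U / (density U * enthalpy U)).

Definition flux1 U : 'rV[R]_4 :=
  let v := velocity U in let m := cm U in
  vec4 (cD U * v.1) (m.1 * v.1 + pressure U) (m.2 * v.1) m.1.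
Definition flux2 U : 'rV[R]_4 :=
  let v := velocity U in let m := cm U in
  vec4 (cD U * v.2) (m.1 * v.2) (m.2 * v.2 + pressure U) m.2.
Definition nflux (n : R * R) U : 'rV[R]_4 := n.1 *: flux1 U + n.2 *: flux2 U.

Definition vn (n : R * R) U : R := dot (velocity U) n.

Definition wave_radical (n : R * R) U : R :=
  sound U * (lorentz U)^-1 *
  Num.sqrt (1 - vn n U ^+ 2
            - (enorm (velocity U) ^+ 2 - vn n U ^+ 2) * sound U ^+ 2).
Definition wave_denom U : R := 1 - enorm (velocity U) ^+ 2 * sound U ^+ 2.

Definition lambda1 (n : R * R) U : R :=
  (vn n U * (1 - sound U ^+ 2) - wave_radical n U) / wave_denom U.
Definition lambda4 (n : R * R) U : R :=
  (vn n U * (1 - sound U ^+ 2) + wave_radical n U) / wave_denom U.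
Definition sigma_hat U (n : R * R) : R :=
  (`|vn n U| * (1 - sound U ^+ 2) + wave_radical n U) / wave_denom U.

Definition sigma_l (Um Up : 'rV[R]_4) n : R :=
  Num.min (lambda1 n Um) (Num.min (lambda1 n Up) 0).
Definition sigma_r (Um Up : 'rV[R]_4) n : R :=
  Num.max (lambda4 n Um) (Num.max (lambda4 n Up) 0).

Definition hll (Um Up : 'rV[R]_4) n : 'rV[R]_4 :=
  let sl := sigma_l Um Up n in let sr := sigma_r Um Up n in
  (sr - sl)^-1 *: (sr *: nflux n Um - sl *: nflux n Up + (sl * sr) *: (Up - Um)).

End RHD.

(* Conforming triangulation of a planar domain.  The vertices of a cell are
   listed counterclockwise; its edge j goes from vertex j+1 to vertex j+2 (mod
   3), i.e. it is opposite to vertex j.  A mesh may be infinite if it is locally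
   finite (e.g. a mesh of the whole plane).  Edge j of K is shared with the edge
   (nbr K j).2 of the cell (nbr K j).1, onto which it is carried by the
   translation by shift K j: the shift vanishes on edges common to two cells, and
   is nonzero only on identified (e.g. periodic) boundary edges.  Translated edges
   have opposite orientations, so the two cells lie on opposite sides. *)
Record mesh (R : realType) := Mesh {
  cell : Type;
  vtx : cell -> 'I_3 -> R * R;
  domain : set (R * R);
  nbr : cell -> 'I_3 -> cell * 'I_3;
  shift : cell -> 'I_3 -> R * R;
  vtx_ccw : forall K,
    0 < ((vtx K 1).1 - (vtx K 0).1) * ((vtx K 2%:R).2 - (vtx K 0).2)
        - ((vtx K 1).2 - (vtx K 0).2) * ((vtx K 2%:R).1 - (vtx K 0).1);
  domain_open : open domain;
  domain_connected : connected domain;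
  domain_nonempty : domain !=set0;
  cells_cover : \bigcup_(K in [set: cell]) triangle (vtx K) = closure domain;
  cells_locally_finite : forall r : R,
    finite_set [set K | exists2 x, triangle (vtx K) x & enorm x <= r];
  cells_conforming : forall K K', K <> K' ->
    let I := triangle (vtx K) `&` triangle (vtx K') in
    [\/ I = set0,
        exists i i', I = [set vtx K i] /\ I = [set vtx K' i']
      | exists j j', I = segment (vtx K (j + 1)) (vtx K (j + 2%:R)) /\
                     I = segment (vtx K' (j' + 1)) (vtx K' (j' + 2%:R))];
  nbr_involutive : forall K j, nbr (nbr K j).1 (nbr K j).2 = (K, j);
  nbr_translate : forall K j,
    let K' := (nbr K j).1 in let j' := (nbr K j).2 in
    vtx K' (j' + 1) = vtx K (j + 2%:R) + shift K j /\
    vtx K' (j' + 2%:R) = vtx K (j + 1) + shift K j;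
  nbr_interior : forall K j K' j', K <> K' ->
    segment (vtx K (j + 1)) (vtx K (j + 2%:R)) =
      segment (vtx K' (j' + 1)) (vtx K' (j' + 2%:R)) ->
    nbr K j = (K', j') /\ shift K j = 0
}.

Section Quadrature.
Variables (R : realType) (Q : nat).

(* Q-point Gauss rule transported to [0, 1]: the rule with Q nodes that is
   exact in degree <= 2Q - 1.  Since size p = deg p + 1, this is size p <= 2Q;
   exactness on constants is the normalization of the weights. *)
Definition gauss_rule (s w : 'I_Q -> R) : Prop :=
  [/\ injective s,
      forall q, 0 <= s q <= 1,
      forall q, 0 < w q &
      forall p : {poly R}, (size p <= 2 * Q)%N ->
        (\int[@lebesgue_measure R]_(t in `[0, 1]) p.[t] = \sum_q w q * p.[s q])%R].

End Quadrature.

Section Discrete.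
Variables (R : realType) (M : mesh R).
Implicit Types (K : cell M) (j : 'I_3).

Definition edge_vec K j : R * R := vtx K (j + 2%:R) - vtx K (j + 1).
Definition edge_len K j : R := enorm (edge_vec K j).

Definition normal K j : R * R :=
  (edge_len K j)^-1 *: ((edge_vec K j).2, - (edge_vec K j).1).

Definition area K : R := fine (@mu2 R (triangle (vtx K))).

Definition poly2_le (k : nat) (f : R * R -> R) : Prop :=
  exists c : nat -> nat -> R, forall x,
    f x = \sum_(a < k.+1) \sum_(b < k.+1 | (a + b <= k)%N)
            c a b * x.1 ^+ a * x.2 ^+ b.

(* A discontinuous piecewise polynomial is given by its polynomial piece on
   each cell, so it has one value per cell at a point lying on several cells.
   Being continuous, the piece u K takes at a point of the cell K the value of
   the limit from inside K. *)
Definition pw_fun := cell M -> R * R -> 'rV[R]_4.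
Implicit Types u : pw_fun.

Definition Vh (k : nat) : set pw_fun :=
  [set u | forall K (i : 'I_4), poly2_le k (fun x => u K x 0 i)].

Definition avg u K : 'rV[R]_4 :=
  \row_i ((area K)^-1 * (\int[@mu2 R]_(x in triangle (vtx K)) u K x 0 i)%R).

Definition nquad (k : nat) : nat := uphalf (k + 3).
Definition omega1 (k : nat) : R := 1 / ((nquad k)%:R * ((nquad k)%:R - 1)).

Variables (Gam : R) (Q : nat) (s w : 'I_Q -> R).
Implicit Type q : 'I_Q.

Definition qpoint K j q : R * R :=
  (1 - s q) *: vtx K (j + 1) + s q *: vtx K (j + 2%:R).

Definition uint u K j q : 'rV[R]_4 := u K (qpoint K j q).
Definition uext u K j q : 'rV[R]_4 :=
  u (nbr K j).1 (qpoint K j q + shift K j).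

Definition Gh (k : nat) : set pw_fun :=
  [set u | Vh k u /\ forall K,
    [/\ Gu Gam (avg u K),
        forall j q, Gu Gam (uint u K j q) &
        Gu Gam ((1 - 2 * omega1 k)^-1 *:
          (avg u K - (2 / 3 * omega1 k) *:
             \sum_(j < 3) \sum_(q < Q) w q *: uint u K j q))]].

(* The default value 0 of the maximum is neutral: sigma_hat is nonnegative on
   Gu. *)
Definition sigmaK u K j : R :=
  \big[Num.max/0]_(q < Q)
    Num.max (sigma_hat Gam (uint u K j q) (normal K j))
            (sigma_hat Gam (uext u K j q) (normal K j)).

Definition LK u K : 'rV[R]_4 :=
  - ((area K)^-1 *: \sum_(j < 3) edge_len K j *:
       \sum_(q < Q) w q *: hll Gam (uint u K j q) (uext u K j q) (normal K j)).

End Discrete.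

(* Main.v *)
Require Import Defs.
From mathcomp Require Import all_boot all_order all_algebra.
From mathcomp Require Import all_classical all_reals all_analysis.
From mathcomp Require Import unstable zify ring lra.
Import Order.TTheory GRing.Theory Num.Theory numFieldNormedType.Exports.
Local Open Scope ring_scope.

(** The admissible set is the open convex cone D > 0, E > 0,
    D^2 + |m|^2 < E^2 ([Gu_open_cone], [open_cone_Gu]), so that adding to an
    admissible state any vector of the closed cone D >= 0, E >= 0,
    D^2 + |m|^2 <= E^2 leaves it admissible ([open_closed_add]).  The proof
    writes the updated cell average as an admissible state plus vectors of the
    closed cone.

    The admissible state is (1 - 2 omega) times the third state required to be
    admissible by the definition of the space [Gh].  What remains of the cell
    average is (2/3) omega times a weighted sum of the interior edge values,
    and each edge value U- is paired with the numerical flux through the same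
    quadrature point.  The HLL flux satisfies

      F_hll = sr U- - [sr (sr U- - n.F(U-)) - sl (sr U+ - n.F(U+))] / (sr - sl)

    with sl <= 0 <= sr, so a U- - b F_hll is the sum of (a - b sr) U- and of
    nonnegative multiples of sr U- - n.F(U-) and sr U+ - n.F(U+).  The first
    coefficient is nonnegative by the CFL condition, since sr is at most the
    wave speed appearing there.

    The physical input is that l U - n.F(U) lies in the closed cone as soon as
    l is at least the largest wave speed of U ([lambda4_flux_cone]).  At
    l = lambda4 the speed is a root of the acoustic characteristic equation
      (1 - cs^2) (l - vn)^2 = cs^2 (1 - |v|^2) (1 - l^2)
    ([acoustic_speed]); eliminating 1 - l^2 with it turns E^2 - D^2 - |m|^2 at
    l U - n.F(U) into (l - vn)^2 times a quantity which is nonnegative exactly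
    because Gamma / (Gamma - 1) >= 2.

    The values from the neighbouring cell are admissible because they are
    edge values of that cell at its own quadrature points.  The common edge is
    run through in opposite directions from its two sides, hence this needs
    the Gauss nodes to be symmetric about 1/2 ([gauss_nodes_symmetric]). *)

(** * The Euclidean plane *)

Section Plane.
Variable R : realType.
Implicit Types x y : R * R.

Lemma dotxx_ge0 x : 0 <= dot x x.
Proof. by rewrite /dot addr_ge0 // -expr2 sqr_ge0. Qed.

Lemma enorm_sqr x : enorm x ^+ 2 = dot x x.
Proof. exact: sqr_sqrtr (dotxx_ge0 x). Qed.

Lemma dot_scale (a : R) x y : dot (a *: x) y = a * dot x y.
Proof. by rewrite /dot /= /GRing.scale /=; ring. Qed.

Lemma dot_Cauchy_Schwarz x y : dot x y ^+ 2 <= dot x x * dot y y.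
Proof.
have := sqr_ge0 (x.1 * y.2 - x.2 * y.1); rewrite /dot; lra.
Qed.

Lemma enorm_lt1 x : (enorm x < 1) = (dot x x < 1).
Proof. by rewrite /enorm -[X in _ < X = _]sqrtr1 ltr_sqrt. Qed.

End Plane.

(** * The cones of causal states *)

Section Cone.
Variable R : realType.
Implicit Types (U V : 'rV[R]_4) (a : R).

Lemma cD_add U V : cD (U + V) = cD U + cD V. Proof. by rewrite /cD mxE. Qed.
Lemma cE_add U V : cE (U + V) = cE U + cE V. Proof. by rewrite /cE mxE. Qed.
Lemma cm_add U V : cm (U + V) = cm U + cm V.
Proof. by rewrite /cm !mxE. Qed.
Lemma cD_scale a U : cD (a *: U) = a * cD U. Proof. by rewrite /cD mxE. Qed.
Lemma cE_scale a U : cE (a *: U) = a * cE U. Proof. by rewrite /cE mxE. Qed.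
Lemma cm_scale a U : cm (a *: U) = a *: cm U.
Proof. by rewrite /cm !mxE. Qed.

Definition closed_cone : set 'rV[R]_4 :=
  [set U | [/\ 0 <= cD U, 0 <= cE U & cD U ^+ 2 + dot (cm U) (cm U) <= cE U ^+ 2]].
Definition open_cone : set 'rV[R]_4 :=
  [set U | [/\ 0 < cD U, 0 < cE U & cD U ^+ 2 + dot (cm U) (cm U) < cE U ^+ 2]].

Lemma open_coneW U : open_cone U -> closed_cone U.
Proof. by case=> a b c; split; apply: ltW. Qed.

(** Cauchy-Schwarz in the three-dimensional space of the vectors (D, m): it
    makes both cones stable under addition. *)
Lemma closed_cone_cross U V : closed_cone U -> closed_cone V ->
  cD U * cD V + dot (cm U) (cm V) <= cE U * cE V.
Proof.
move=> [D0 E0 H] [D0' E0' H'].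
apply: le_trans (ler_norm _) _.
rewrite -ler_sqr ?nnegrE ?mulr_ge0 ?normr_ge0 // real_normK ?num_real // exprMn.
apply: le_trans (_ : (cD U ^+ 2 + dot (cm U) (cm U)) *
   (cD V ^+ 2 + dot (cm V) (cm V)) <= _); last first.
  by apply: ler_pM => //; rewrite addr_ge0 ?sqr_ge0 ?dotxx_ge0.
rewrite /dot.
have := sqr_ge0 (cD U * (cm V).1 - cD V * (cm U).1).
have := sqr_ge0 (cD U * (cm V).2 - cD V * (cm U).2).
have := sqr_ge0 ((cm U).1 * (cm V).2 - (cm V).1 * (cm U).2).
lra.
Qed.

Lemma dot_addadd (x y : R * R) :
  dot (x + y) (x + y) = dot x x + 2 * dot x y + dot y y.
Proof. by rewrite /dot /=; ring. Qed.

Lemma closed_cone_add U V : closed_cone U -> closed_cone V -> closed_cone (U + V).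
Proof.
move=> KU KV; have := closed_cone_cross _ _ KU KV.
case: KU KV => D0 E0 H [D0' E0' H'] X; split.
- by rewrite cD_add addr_ge0.
- by rewrite cE_add addr_ge0.
- rewrite cD_add cE_add cm_add dot_addadd; lra.
Qed.

Lemma open_closed_add U V : open_cone U -> closed_cone V -> open_cone (U + V).
Proof.
move=> KU KV; have := closed_cone_cross _ _ (open_coneW _ KU) KV.
case: KU KV => D0 E0 H [D0' E0' H'] X; split.
- by rewrite cD_add ltr_wpDr.
- by rewrite cE_add ltr_wpDr.
- rewrite cD_add cE_add cm_add dot_addadd; lra.
Qed.

Lemma dot_scalescale a (x : R * R) : dot (a *: x) (a *: x) = a ^+ 2 * dot x x.
Proof. by rewrite /dot /= /GRing.scale /=; ring. Qed.

Lemma closed_cone_scale a U : 0 <= a -> closed_cone U -> closed_cone (a *: U).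
Proof.
move=> a0 [D0 E0 H]; split.
- by rewrite cD_scale mulr_ge0.
- by rewrite cE_scale mulr_ge0.
- by rewrite cD_scale cE_scale cm_scale dot_scalescale !exprMn -mulrDr
    ler_wpM2l ?sqr_ge0.
Qed.

Lemma open_cone_scale a U : 0 < a -> open_cone U -> open_cone (a *: U).
Proof.
move=> a0 [D0 E0 H]; split.
- by rewrite cD_scale mulr_gt0.
- by rewrite cE_scale mulr_gt0.
- by rewrite cD_scale cE_scale cm_scale dot_scalescale !exprMn -mulrDr
    ltr_pM2l ?exprn_gt0.
Qed.

Lemma closed_cone0 : closed_cone 0.
Proof. by split; rewrite /cD /cE /cm /dot !mxE /= ?lexx // !mul0r expr0n /= !addr0. Qed.

Lemma closed_cone_sum (I : finType) (F : I -> 'rV[R]_4) :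
  (forall i, closed_cone (F i)) -> closed_cone (\sum_i F i).
Proof.
move=> H; apply: (big_ind closed_cone) => //; first exact: closed_cone0.
exact: closed_cone_add.
Qed.

(** The inequality |x|^2 <= E^2 describes a double cone.  Pairing with a single
    timelike vector (1, v), |v| < 1, tells its two halves apart: on the half
    E <= - |x| the value E - v.x is negative away from the apex. *)
Lemma cone_energy_ge0 (E : R) (x v : R * R) :
  dot v v < 1 -> dot x x <= E ^+ 2 -> dot v x <= E -> 0 <= E.
Proof.
move=> v1 xE vE; rewrite leNgt; apply/negP => E0.
have vx := dot_Cauchy_Schwarz R v x.
have : E ^+ 2 <= dot v x ^+ 2.
  by rewrite -(sqrrN E) -(sqrrN (dot v x)) lerXn2r ?nnegrE; lra.
have : dot v v * dot x x <= dot v v * E ^+ 2 by rewrite ler_wpM2l ?dotxx_ge0.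
have : 0 < E ^+ 2 by rewrite exprn_even_gt0 //= lt_eqF.
move=> a b c; have : (1 - dot v v) * E ^+ 2 <= 0 by lra.
by rewrite pmulr_lle0 // leNgt subr_gt0 v1.
Qed.
End Cone.

(** * The admissible set is the open cone *)

Section Primitive.
Variables (R : realType) (Gam : R).
Hypothesis hGam : 1 < Gam <= 2.
Let g := Gam / (Gam - 1).

(** The number g = Gamma / (Gamma - 1) enters through rho H = rho + g p; the bound
    g >= 2 is the form in which Gamma <= 2 is used in the estimates. *)
Lemma Gam_bounds : 2 <= g /\ Gam * (g - 1) = g.
Proof.
case/andP: hGam => h1 h2.
have e : g = 1 + (Gam - 1)^-1 by rewrite /g; field; rewrite subr_eq0 gt_eqF.
have i0 : 0 < (Gam - 1)^-1 by rewrite invr_gt0 subr_gt0.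
have i1 : 1 <= (Gam - 1)^-1 by rewrite invf_ge1 ?subr_gt0 //; lra.
split; rewrite ?e; try lra.
by field; rewrite subr_eq0 gt_eqF.
Qed.

(** The equation Phi_U(p) = 0, rewritten with v = m / (E + p), is
    (E + p) (1 - |v|^2) = rho + g p, that is (E + p) / gamma^2 = rho H.  It
    forces E + p > 0, whatever the sign of E. *)
Lemma Gu_recover U : Gu Gam U ->
  let p := pressure Gam U in let v := velocity Gam U in let r := density Gam U in
  [/\ 0 < p, 0 < r, dot v v < 1, 0 < cE U + p &
   [/\ cm U = (cE U + p) *: v, 0 < cD U,
       r = cD U * Num.sqrt (1 - dot v v) &
       (cE U + p) * (1 - dot v v) = r + g * p]].
Proof.
move=> [r0 p0 v1] p v r.
move: v1; rewrite enorm_lt1 => v1.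
have b0 : 0 < Num.sqrt (1 - dot v v) by rewrite sqrtr_gt0 subr_gt0.
have rE : r = cD U * Num.sqrt (1 - dot v v) by rewrite /r /density enorm_sqr.
have Phi0 : Phi Gam U p = 0.
  move: p0; rewrite /p /pressure; case: xgetP => [y -> /= [] //|_].
  by rewrite ltxx.
have G1 : Gam - 1 != 0 by case/andP: hGam => h1 _; rewrite subr_eq0 gt_eqF.
have vv : dot v v = dot (cm U) (cm U) / (cE U + p) ^+ 2.
  by rewrite /v /velocity -/p dot_scalescale exprVn mulrC.
(* When E + p = 0 the velocity is 0 by the convention y / 0 = 0, and the
   identity still holds. *)
have hv : (cE U + p) * dot v v = dot (cm U) (cm U) / (cE U + p).
  have [->|h0] := eqVneq (cE U + p) 0; first by rewrite invr0 mul0r mulr0.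
  by rewrite vv; field.
have key : (cE U + p) * (1 - dot v v) = r + g * p.
  move: Phi0; rewrite /Phi !enorm_sqr -vv -hv -rE => Phi0.
  have -> : g * p = p / (Gam - 1) + p by rewrite /g; field.
  lra.
have g0 : 0 < g by case: Gam_bounds => g2 _; exact: lt_le_trans g2.
have h0 : 0 < cE U + p.
  have : 0 < (cE U + p) * (1 - dot v v).
    by rewrite key; apply: addr_gt0 => //; exact: mulr_gt0.
  by rewrite pmulr_lgt0 // subr_gt0.
split => //; split => //.
- by rewrite /v /velocity -/p scalerA divff ?scale1r // gt_eqF.
- by move: r0; rewrite -/r rE pmulr_lgt0.
Qed.

(** Multiplied by 1 - |v|^2, the gap E^2 - D^2 - |m|^2 becomes
    (rho H)^2 - 2 p rho H - rho^2 + p^2 (1 - |v|^2), and rho H >= rho + 2 p. *)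
Lemma Gu_open_cone U : Gu Gam U -> open_cone R U.
Proof.
move=> /Gu_recover[].
set p := pressure Gam U; set v := velocity Gam U; set r := density Gam U.
move=> p0 r0 v1 h0 [mE D0 rE hE].
have [g2 _] := Gam_bounds.
have a0 : 0 < 1 - dot v v by rewrite subr_gt0.
have gp : 2 * p <= g * p by rewrite ler_pM2r.
have hge : r + g * p <= cE U + p.
  rewrite -hE; have := dotxx_ge0 R v => vv.
  by apply: ler_piMr; [exact: ltW|lra].
have r2 : cD U ^+ 2 * (1 - dot v v) = r ^+ 2.
  by rewrite rE exprMn sqr_sqrtr // ltW.
split => //; first lra.
rewrite -subr_gt0 -(pmulr_lgt0 _ a0) mE dot_scalescale.
set h := cE U + p in h0 hE hge *; have -> : cE U = h - p by rewrite /h addrK.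
have -> : ((h - p) ^+ 2 - (cD U ^+ 2 + h ^+ 2 * dot v v)) * (1 - dot v v) =
  (h * (1 - dot v v)) ^+ 2 - 2 * p * (h * (1 - dot v v))
  + p ^+ 2 * (1 - dot v v) - cD U ^+ 2 * (1 - dot v v) by ring.
rewrite r2 hE.
have -> : (r + g * p) ^+ 2 - 2 * p * (r + g * p) + p ^+ 2 * (1 - dot v v) - r ^+ 2
  = 2 * (r * p) * (g - 1) + (g * p) * (g * p - 2 * p) + p ^+ 2 * (1 - dot v v) by ring.
have t1 : 0 < 2 * (r * p) * (g - 1).
  by apply: mulr_gt0; [apply: mulr_gt0 => //; exact: mulr_gt0|lra].
have t2 : 0 <= (g * p) * (g * p - 2 * p) by apply: mulr_ge0; lra.
have t3 : 0 < p ^+ 2 * (1 - dot v v) by apply: mulr_gt0 => //; exact: exprn_gt0.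
lra.
Qed.

(** In the open cone Phi_U(0) < 0 < Phi_U(E), so Phi_U has a nonnegative root,
    and no such root is 0.  This suffices: any root gives |v| < 1. *)
Lemma open_cone_Gu U : open_cone R U -> Gu Gam U.
Proof.
move=> [D0 E0 H].
set D := cD U in D0 H *; set E := cE U in E0 H *.
set mm := dot (cm U) (cm U) in H *.
have mm0 : 0 <= mm by exact: dotxx_ge0.
have G10 : 0 < Gam - 1 by case/andP: hGam => h1 _; rewrite subr_gt0.
have mE2 : mm < E ^+ 2 by have := sqr_ge0 D; lra.
have vlt1 p : 0 <= p -> mm / (E + p) ^+ 2 < 1.
  move=> p0; rewrite ltr_pdivrMr ?mul1r ?exprn_gt0 ?ltr_wpDr //.
  by apply: lt_le_trans mE2 _; rewrite lerXn2r ?nnegrE //; lra.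
have Phi0 : Phi Gam U 0 < 0.
  rewrite /Phi !enorm_sqr mul0r !addr0 -/E -/D -/mm.
  set b := Num.sqrt _.
  have b2 : b ^+ 2 = 1 - mm / E ^+ 2.
    by rewrite sqr_sqrtr // subr_ge0 ltW // -[E]addr0 vlt1.
  have b0 : 0 < b by rewrite sqrtr_gt0 subr_gt0 -[E]addr0 vlt1.
  have e : mm / E = E - E * b ^+ 2 by rewrite b2; field; rewrite gt_eqF.
  have DEb : D < E * b.
    rewrite -ltr_sqr ?nnegrE ?mulr_ge0 ?ltW // exprMn.
    have -> : E ^+ 2 * b ^+ 2 = E ^+ 2 - mm by rewrite b2; field; rewrite gt_eqF.
    lra.
  have : D * b < E * b * b by rewrite ltr_pM2r.
  rewrite e; lra.
have PhiE : 0 < Phi Gam U E.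
  rewrite /Phi !enorm_sqr -/E -/D -/mm.
  (* The endpoint p = E is large enough because Gamma - 1 <= 1. *)
  have t1 : E <= E / (Gam - 1).
    by rewrite ler_pdivlMr //; apply: ler_piMr; [exact: ltW|case/andP: hGam => _ ?; lra].
  have t2 : 0 <= mm / (E + E) by rewrite divr_ge0 //; lra.
  have t3 : 0 < D * Num.sqrt (1 - mm / (E + E) ^+ 2).
    by rewrite mulr_gt0 // sqrtr_gt0 subr_gt0 vlt1 // ltW.
  lra.
have cPhi : ({within `[0, E]%classic, continuous (Phi Gam U)})%classic.
  apply/continuous_in_subspaceT => x; rewrite inE /= in_itv /= => /andP[x0 xE].
  have hx : cE U + x != 0 by rewrite gt_eqF // ltr_wpDr.
  have cadd : {for x, continuous (fun p : R => cE U + p)}.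
    by apply: cvgD; [exact: cvg_cst|exact: cvg_id].
  have cinv : {for x, continuous (fun p : R => (cE U + p)^-1)}.
    exact: cvgV.
  have cinv2 : {for x, continuous (fun p : R => ((cE U + p) ^+ 2)^-1)}.
    apply: cvgV; first by rewrite expf_neq0.
    exact: cvgM.
  apply: cvgD; last first.
    apply: cvgM; first exact: cvg_cst.
    apply: (@continuous_comp _ _ _
      (fun p : R => 1 - enorm (cm U) ^+ 2 / (cE U + p) ^+ 2) (@Num.sqrt R)); last first.
      exact: sqrt_continuous.
    by apply: cvgB; [exact: cvg_cst|apply: cvgM => //; exact: cvg_cst].
  apply: cvgD; last by apply: cvgM => //; exact: cvg_cst.
  apply: cvgB; last exact: cvg_cst.
  by apply: cvgM; [exact: cvg_id|exact: cvg_cst].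
have [|p0] := @IVT R (Phi Gam U) 0 E 0 (ltW E0) cPhi.
  by rewrite ge_min le_max (ltW Phi0) (ltW PhiE) orbT.
rewrite in_itv /= => /andP[pge0 pleE] Pp.
have [q0 Pq] : 0 <= pressure Gam U /\ Phi Gam U (pressure Gam U) = 0.
  rewrite /pressure; case: xgetP => [y -> //|/(_ p0)] []; split => //.
have p0' : 0 < pressure Gam U.
  rewrite lt_neqAle q0 andbT; apply/eqP => e.
  by move: Phi0; rewrite [X in Phi _ _ X]e Pq ltxx.
have vv : dot (velocity Gam U) (velocity Gam U) < 1.
  by rewrite /velocity dot_scalescale exprVn mulrC vlt1.
split => //; last by rewrite enorm_lt1.
by rewrite /density mulr_gt0 // enorm_sqr sqrtr_gt0 subr_gt0.
Qed.
End Primitive.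

(** * The largest wave speed *)

Section Wave.
Variable R : realType.

(** The formula for lambda4 is the larger root of the acoustic quadratic, with
    s = cs, V = |v|^2 and x = vn: multiplying by 1 - V s^2 completes the
    square.  The bound x <= l reduces to (x s)^2 (1 - V) <= T for the radicand
    T of the formula, whose gap is (1 - x^2) (1 - V s^2). *)
Lemma acoustic_speed (s V x : R) :
  0 <= s -> s ^+ 2 < 1 -> 0 <= V < 1 -> x ^+ 2 <= V ->
  let l := (x * (1 - s ^+ 2) + s * Num.sqrt (1 - V) *
       Num.sqrt (1 - x ^+ 2 - (V - x ^+ 2) * s ^+ 2)) / (1 - V * s ^+ 2) in
  x <= l /\ (1 - s ^+ 2) * (l - x) ^+ 2 = s ^+ 2 * (1 - V) * (1 - l ^+ 2).
Proof.
move=> s0 s1 /andP[V0 V1] xV l.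
have ss0 : 0 <= s ^+ 2 by exact: sqr_ge0.
have Vs : V * s ^+ 2 <= s ^+ 2 by apply: ler_piMl => //; exact: ltW.
have den0 : 0 < 1 - V * s ^+ 2 by lra.
set b := Num.sqrt (1 - V) in l *.
have b2 : b ^+ 2 = 1 - V by rewrite sqr_sqrtr //; lra.
have b0 : 0 <= b by exact: sqrtr_ge0.
set T := 1 - x ^+ 2 - (V - x ^+ 2) * s ^+ 2 in l *.
have xsb : (x * s * b) ^+ 2 <= T.
  have : 0 <= (1 - x ^+ 2) * (1 - V * s ^+ 2) by apply: mulr_ge0; lra.
  rewrite !exprMn b2 /T; lra.
have S2 : Num.sqrt T ^+ 2 = T.
  by rewrite sqr_sqrtr //; apply: le_trans xsb; exact: sqr_ge0.
have ldef : l * (1 - V * s ^+ 2) = x * (1 - s ^+ 2) + s * b * Num.sqrt T.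
  by rewrite /l divfK // gt_eqF.
split.
  rewrite -(ler_pM2r den0) ldef.
  have -> : x * (1 - V * s ^+ 2) = x * (1 - s ^+ 2) + s * b * (x * s * b).
    have -> : s * b * (x * s * b) = x * s ^+ 2 * b ^+ 2 by ring.
    rewrite b2; ring.
  rewrite lerD2l ler_wpM2l ?mulr_ge0 //.
  by apply: le_trans (ler_norm _) _; rewrite -sqrtr_sqr ler_wsqrtr.
apply/eqP; rewrite -subr_eq0 -(mulIr_eq0 _ (mulIf (lt0r_neq0 den0))).
have -> : ((1 - s ^+ 2) * (l - x) ^+ 2 - s ^+ 2 * (1 - V) * (1 - l ^+ 2)) *
  (1 - V * s ^+ 2) = (l * (1 - V * s ^+ 2)) ^+ 2
   - 2 * x * (1 - s ^+ 2) * (l * (1 - V * s ^+ 2))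
   + (1 - V * s ^+ 2) * (x ^+ 2 * (1 - s ^+ 2) - s ^+ 2 * (1 - V)) by ring.
rewrite ldef.
have -> (y z : R) : (y + z) ^+ 2 - 2 * x * (1 - s ^+ 2) * (y + z) =
  z ^+ 2 + y ^+ 2 + 2 * y * z - 2 * x * (1 - s ^+ 2) * (y + z) by ring.
rewrite !exprMn b2 S2 /T; apply/eqP; ring.
Qed.

End Wave.

(** * The flux cone property and the HLL flux *)

Section Flux.
Variables (R : realType) (Gam : R).
Implicit Types U : 'rV[R]_4.

Lemma cD_vec4 (a b c d : R) : cD (vec4 a b c d) = a.
Proof. by rewrite /cD mxE. Qed.
Lemma cE_vec4 (a b c d : R) : cE (vec4 a b c d) = d.
Proof. by rewrite /cE mxE. Qed.
Lemma cm_vec4 (a b c d : R) : cm (vec4 a b c d) = (b, c).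
Proof. by rewrite /cm !mxE. Qed.

Lemma cD_nflux n U : cD (nflux Gam n U) = cD U * vn Gam n U.
Proof. by rewrite /nflux cD_add !cD_scale !cD_vec4 /vn /dot; ring. Qed.

Lemma cm_nflux n U :
  cm (nflux Gam n U) = vn Gam n U *: cm U + pressure Gam U *: n.
Proof.
rewrite /nflux cm_add !cm_scale !cm_vec4 /vn /dot.
by apply/eqP; rewrite /eq_op /= /GRing.scale /=; apply/andP; split; apply/eqP; ring.
Qed.

Lemma cE_nflux n U : cE (nflux Gam n U) = dot (cm U) n.
Proof. by rewrite /nflux cE_add !cE_scale !cE_vec4 /dot; ring. Qed.

Hypothesis hGam : 1 < Gam <= 2.
Let g := Gam / (Gam - 1).

(** Sound is subluminal: cs^2 = Gamma p / (rho + g p) with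
    Gamma p <= 2 p <= g p. *)
Lemma sound_sqr U : Gu Gam U ->
  [/\ sound Gam U ^+ 2 * (density Gam U + g * pressure Gam U)
        = Gam * pressure Gam U & sound Gam U ^+ 2 < 1].
Proof.
move=> /(Gu_recover _ _ hGam) [p0 r0 _ _ _].
have [g2 _] := Gam_bounds _ _ hGam; rewrite -/g in g2.
have G0 : 0 < Gam by case/andP: hGam => h _; lra.
rewrite /sound /enthalpy -/g.
set p := pressure Gam U in p0 *; set r := density Gam U in r0 *.
have N0 : 0 < r + g * p.
  by apply: addr_gt0 => //; apply: mulr_gt0 => //; lra.
have -> : r * (1 + g * (p / r)) = r + g * p by field; rewrite gt_eqF.
have q0 : 0 <= Gam * p / (r + g * p).
  by apply: divr_ge0; [apply: mulr_ge0; exact: ltW|exact: ltW].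
rewrite sqr_sqrtr //; split; first by rewrite divfK // gt_eqF.
rewrite ltr_pdivrMr // mul1r.
have gp1 : 2 * p <= g * p by rewrite ler_pM2r.
have hG2 : Gam * p <= 2 * p by rewrite ler_pM2r //; case/andP: hGam.
lra.
Qed.

Lemma vn_sqr n U : dot n n = 1 ->
  vn Gam n U ^+ 2 <= dot (velocity Gam U) (velocity Gam U).
Proof.
by move=> n1; have := dot_Cauchy_Schwarz _ (velocity Gam U) n; rewrite n1 mulr1.
Qed.

Lemma lambda4_spec n U : Gu Gam U -> dot n n = 1 ->
  let l := lambda4 Gam n U in
  vn Gam n U <= l /\
  (1 - sound Gam U ^+ 2) * (l - vn Gam n U) ^+ 2 =
  sound Gam U ^+ 2 * (1 - dot (velocity Gam U) (velocity Gam U)) * (1 - l ^+ 2).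
Proof.
move=> GU n1; rewrite /lambda4 /wave_radical /wave_denom /lorentz invrK enorm_sqr.
have [_ s1] := sound_sqr _ GU.
have [_ _ v1 _ _] := Gu_recover _ _ hGam _ GU.
apply: acoustic_speed => //; first exact: sqrtr_ge0.
- by rewrite dotxx_ge0.
- exact: vn_sqr.
Qed.

(** Put d = lambda4 - vn >= 0, h = E + p and W = lambda4 U - n.F(U).  Then
    W = (D d, h d v - p n, h d - lambda4 p), hence
      E_W^2 - D_W^2 - |m_W|^2
        = d^2 (h^2 (1 - |v|^2) - 2 h p - D^2) - p^2 (1 - lambda4^2).
    The acoustic equation replaces 1 - lambda4^2 by a multiple of d^2, and
    after clearing denominators the coefficient of d^2 is p times
    rho p (2 g - 1) + p^2 g (g - 2).  The sign of E_W is found by pairing W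
    with the fluid velocity: E_W - v.m_W = d (rho H - p). *)
Lemma lambda4_flux_cone n U : Gu Gam U -> dot n n = 1 ->
  closed_cone R (lambda4 Gam n U *: U - nflux Gam n U).
Proof.
move=> GU n1; have [vl lE] := lambda4_spec n U GU n1.
have [cN c1] := sound_sqr _ GU.
have [p0 r0 v1 h0 [mE D0 rE hE]] := Gu_recover _ _ hGam _ GU.
have [g2 Gg] := Gam_bounds _ _ hGam; rewrite -/g in g2 Gg hE.
have G0 : 0 < Gam by case/andP: hGam => h _; lra.
set l := lambda4 Gam n U in vl lE *; set x := vn Gam n U in vl lE *.
set c := sound Gam U ^+ 2 in lE cN c1.
have xE : x = dot (velocity Gam U) n by [].
have -> : l *: U - nflux Gam n U = l *: U + (- 1) *: nflux Gam n U.
  by rewrite scaleN1r.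
set W := _ + _.
have WD : cD W = (l - x) * cD U.
  by rewrite /W cD_add !cD_scale cD_nflux -/x; ring.
set v := velocity Gam U in v1 mE rE hE lE xE.
set p := pressure Gam U in p0 h0 mE hE cN.
set r := density Gam U in r0 rE hE cN.
set h := cE U + p in h0 mE hE.
have Wm : cm W = (l - x) * h *: v - p *: n.
  rewrite /W cm_add !cm_scale cm_nflux -/x -/p mE.
  by apply/eqP; rewrite /eq_op /= /GRing.scale /=; apply/andP; split; apply/eqP; ring.
have WE : cE W = h * (l - x) - l * p.
  rewrite /W cE_add !cE_scale cE_nflux mE dot_scale -xE.
  have -> : cE U = h - p by rewrite /h addrK.
  ring.
have a0 : 0 < 1 - dot v v by rewrite subr_gt0.
have r2 : cD U ^+ 2 * (1 - dot v v) = r ^+ 2.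
  by rewrite rE exprMn sqr_sqrtr // ltW.
set d := l - x in WD WE Wm lE.
have d0 : 0 <= d by rewrite subr_ge0.
have gp : 2 * p <= g * p by rewrite ler_pM2r.
have dotW : dot (cm W) (cm W) = d ^+ 2 * h ^+ 2 * dot v v
    - 2 * d * h * p * x + p ^+ 2.
  have -> : p ^+ 2 = p ^+ 2 * dot n n by rewrite n1 mulr1.
  rewrite Wm xE /dot /= /GRing.scale /=; ring.
have c0 : 0 < c.
  have Gp : 0 < Gam * p by exact: mulr_gt0.
  have N0 : 0 < r + g * p by apply: addr_gt0 => //; apply: mulr_gt0 => //; lra.
  by move: Gp; rewrite -cN pmulr_lgt0.
have main : cD W ^+ 2 + dot (cm W) (cm W) <= cE W ^+ 2.
  (* Multiply by 1 - |v|^2, cs^2 and rho H, all positive, to clear the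
     denominators hidden in h, D, 1 - lambda4^2 and cs^2. *)
  rewrite -subr_ge0 -(pmulr_rge0 _ a0) -(pmulr_rge0 _ c0).
  have N0 : 0 < r + g * p by apply: addr_gt0 => //; apply: mulr_gt0 => //; lra.
  rewrite -(pmulr_rge0 _ N0) WD WE dotW.
  have -> : (h * d - l * p) ^+ 2 - ((d * cD U) ^+ 2 +
     (d ^+ 2 * h ^+ 2 * dot v v - 2 * d * h * p * x + p ^+ 2)) =
     d ^+ 2 * (h ^+ 2 * (1 - dot v v) - 2 * h * p - cD U ^+ 2)
     - p ^+ 2 * (1 - l ^+ 2).
    have -> : l = d + x by rewrite /d subrK.
    ring.
  have -> : (r + g * p) * (c * ((1 - dot v v) *
     (d ^+ 2 * (h ^+ 2 * (1 - dot v v) - 2 * h * p - cD U ^+ 2)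
     - p ^+ 2 * (1 - l ^+ 2)))) =
     d ^+ 2 * (c * (r + g * p)) * ((h * (1 - dot v v)) ^+ 2
        - 2 * p * (h * (1 - dot v v)) - cD U ^+ 2 * (1 - dot v v))
     - (r + g * p) * p ^+ 2 * (c * (1 - dot v v) * (1 - l ^+ 2)) by ring.
  rewrite -lE hE r2 cN.
  have -> : d ^+ 2 * (Gam * p) *
    ((r + g * p) ^+ 2 - 2 * p * (r + g * p) - r ^+ 2) -
    (r + g * p) * p ^+ 2 * ((1 - c) * d ^+ 2) =
    d ^+ 2 * p * (Gam * ((r + g * p) ^+ 2 - 2 * p * (r + g * p) - r ^+ 2)
     - p * (r + g * p) + p * (c * (r + g * p))) by ring.
  rewrite cN.
  have -> : Gam * ((r + g * p) ^+ 2 - 2 * p * (r + g * p) - r ^+ 2)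
     - p * (r + g * p) + p * (Gam * p) =
     2 * (r * p) * (Gam * (g - 1)) + p ^+ 2 * (Gam * (g - 1)) * (g - 1)
     - p * (r + g * p) by ring.
  rewrite Gg.
  have -> : 2 * (r * p) * g + p ^+ 2 * g * (g - 1) - p * (r + g * p)
    = (r * p) * (2 * g - 1) + p ^+ 2 * (g * (g - 2)) by ring.
  apply: mulr_ge0; first by apply: mulr_ge0; [exact: sqr_ge0|exact: ltW].
  apply: addr_ge0; apply: mulr_ge0; rewrite ?sqr_ge0 //.
  - by apply: mulr_ge0; exact: ltW.
  - lra.
  - by apply: mulr_ge0; lra.
split => //.
  by rewrite WD; apply: mulr_ge0 => //; exact: ltW.
apply: (@cone_energy_ge0 _ _ (cm W) v v1).
  by apply: le_trans main; rewrite lerDr sqr_ge0.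
have vW : dot v (cm W) = d * h * dot v v - p * x.
  by rewrite Wm xE /dot /= /GRing.scale /=; ring.
rewrite -subr_ge0 vW WE.
have -> : h * d - l * p - (d * h * dot v v - p * x) = d * (h * (1 - dot v v) - p).
  have -> : l = d + x by rewrite /d subrK.
  ring.
by rewrite hE; apply: mulr_ge0 => //; lra.
Qed.

Lemma flux_cone n U l : Gu Gam U -> dot n n = 1 -> lambda4 Gam n U <= l ->
  closed_cone R (l *: U - nflux Gam n U).
Proof.
move=> GU n1 ll.
have -> : l *: U - nflux Gam n U =
  (l - lambda4 Gam n U) *: U + (lambda4 Gam n U *: U - nflux Gam n U).
  by rewrite scalerBl addrA subrK.
apply: closed_cone_add; last exact: lambda4_flux_cone.
apply: closed_cone_scale; first by rewrite subr_ge0.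
exact/open_coneW/(Gu_open_cone _ _ hGam).
Qed.

(** The splitting of the HLL flux into a multiple of U- and two vectors of the
    closed cone, one on each side of the edge.  Each side is measured with sr,
    which dominates lambda4 of both states. *)
Lemma hll_closed_cone n Um Up (a b : R) : Gu Gam Um -> Gu Gam Up -> dot n n = 1 ->
  0 <= b -> 0 <= a -> b * sigma_r Gam Um Up n <= a ->
  closed_cone R (a *: Um - b *: hll Gam Um Up n).
Proof.
move=> Gm Gp n1 b0 a0 ba; rewrite /hll.
set sr := sigma_r _ _ _ _ in ba *; set sl := sigma_l _ _ _ _.
have sr0 : 0 <= sr by rewrite /sr /sigma_r !le_max lexx !orbT.
have srm : lambda4 Gam n Um <= sr by rewrite /sr /sigma_r !le_max lexx.
have srp : lambda4 Gam n Up <= sr by rewrite /sr /sigma_r !le_max lexx orbT.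
have sl0 : sl <= 0 by rewrite /sl /sigma_l !ge_min lexx !orbT.
have KU : closed_cone R Um by exact/open_coneW/(Gu_open_cone _ _ hGam).
(* If sl = sr = 0 the flux is 0 by the convention y / 0 = 0. *)
have [e|dn] := eqVneq (sr - sl) 0.
  by rewrite e invr0 scale0r scaler0 subr0; exact: closed_cone_scale.
have d0 : 0 < sr - sl by rewrite lt_neqAle eq_sym dn /=; lra.
have -> : a *: Um - b *: ((sr - sl)^-1 *: (sr *: nflux Gam n Um -
     sl *: nflux Gam n Up + (sl * sr) *: (Up - Um))) =
  (a - b * sr) *: Um + ((b * sr / (sr - sl)) *: (sr *: Um - nflux Gam n Um)
  + (b * (- sl) / (sr - sl)) *: (sr *: Up - nflux Gam n Up)).
  by apply/rowP => i; rewrite !mxE; field.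
apply: closed_cone_add; first by apply: closed_cone_scale => //; rewrite subr_ge0.
by apply: closed_cone_add; apply: closed_cone_scale; (try exact: flux_cone);
  apply: divr_ge0; try apply: mulr_ge0; lra.
Qed.

Lemma lambda4_le_sigma_hat n U : Gu Gam U -> lambda4 Gam n U <= sigma_hat Gam U n.
Proof.
move=> GU; have [_ s1] := sound_sqr _ GU.
have [_ _ v1 _ _] := Gu_recover _ _ hGam _ GU.
rewrite /lambda4 /sigma_hat ler_wpM2r //.
  rewrite invr_ge0 /wave_denom enorm_sqr subr_ge0.
  by apply: mulr_ile1; rewrite ?sqr_ge0 ?dotxx_ge0 // ltW.
by rewrite lerD2r ler_wpM2r ?ler_norm // subr_ge0 ltW.
Qed.
End Flux.

(** * Symmetry of the Gauss rule *)

Section Gauss.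
Variables (R : realType) (Q : nat).

Lemma onem_Rintegral (p : {poly R}) :
  (\int[@lebesgue_measure R]_(t in `[0%R, 1%R]%classic) p.[t] =
   \int[@lebesgue_measure R]_(t in `[0%R, 1%R]%classic) (p \Po (1 - 'X)).[t])%R.
Proof.
rewrite Rintegration_by_substitution_onem ?ler01 ?lexx //; last first.
  by apply: continuous_subspaceT => x; exact: continuous_horner.
rewrite onem1; apply: eq_Rintegral => t _.
by rewrite horner_comp !hornerE.
Qed.

(** Otherwise let p, of degree 2Q - 1, vanish exactly at the nodes and at their
    reflections other than 1 - s q.  The rule integrates both p and its
    reflection exactly; it gives 0 for p and w q * p (1 - s q), not 0, for the
    reflection, although the two integrals over [0, 1] are equal. *)
Lemma gauss_nodes_symmetric (s w : 'I_Q -> R) : gauss_rule s w ->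
  forall q, exists q', s q' = 1 - s q.
Proof.
move=> [sinj _ w0 ex] q; apply: contrapT => /forallNP no.
pose nodes := \prod_(r <- enum 'I_Q) ('X - (s r)%:P) : {poly R}.
pose others := \prod_(r <- rem q (enum 'I_Q)) ('X - (1 - s r)%:P) : {poly R}.
pose p := nodes * others.
have szp : (size p <= 2 * Q)%N.
  rewrite size_Mmonic ?monic_prod_XsubC ?monic_neq0 ?monic_prod_XsubC //.
  rewrite !size_prod_XsubC size_rem ?mem_enum // size_enum_ord.
  by rewrite prednK ?addSn ?mul2n -?addnn //; exact: leq_ltn_trans (ltn_ord q).
have hor (I : Type) (l : seq I) (F : I -> R) t :
    (\prod_(r <- l) ('X - (F r)%:P)).[t] = \prod_(r <- l) (t - F r).
  by rewrite horner_prod; apply: eq_bigr => r _; rewrite !hornerE.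
have sz1 : size (1 - 'X : {poly R}) = 2.
  by rewrite -opprB size_polyN size_XsubC.
have := ex (p \Po (1 - 'X)); rewrite size_comp_poly2 // => /(_ szp).
rewrite -onem_Rintegral ex // big1 => [|r _]; last first.
  rewrite hornerM hor (big_rem r) ?mem_enum //= subrr.
  by rewrite !mul0r mulr0.
rewrite (bigD1 q) //= big1 => [|r rq]; last first.
  rewrite horner_comp !hornerE [others.[_]]hor (big_rem r) /=; last first.
    by rewrite mem_rem_uniq ?enum_uniq // inE rq mem_enum.
  by rewrite subrr mul0r !mulr0.
apply/eqP; rewrite addr0 eq_sym; apply: mulf_neq0; first by rewrite gt_eqF.
rewrite horner_comp !hornerE; apply: mulf_neq0.
  rewrite hor prodf_seq_neq0; apply/allP => r _ /=.
  by rewrite subr_eq0; apply/eqP => e; apply: (no r).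
rewrite hor prodf_seq_neq0; apply/allP => r /=.
rewrite mem_rem_uniq ?enum_uniq // inE mem_enum andbT => rq.
apply/eqP => e; move/eqP: rq; apply; apply: sinj; lra.
Qed.
End Gauss.

(** * The updated cell averages *)

Section Mesh.
Variables (R : realType) (M : mesh R).

Lemma dot_normal (K : cell M) j : edge_len K j != 0 -> dot (normal K j) (normal K j) = 1.
Proof.
move=> e0; rewrite /normal dot_scalescale exprVn.
have -> (x y : R) : dot (x, - y) (x, - y) = dot (y, x) (y, x).
  by rewrite /dot /=; ring.
by rewrite -surjective_pairing -enorm_sqr mulVf // expf_neq0.
Qed.

Lemma area_ge0 (K : cell M) : 0 <= area K.
Proof. exact/fine_ge0/measure_ge0. Qed.

(** The two sides parametrize their common edge in opposite directions, so the
    node seen from outside is the reflected one. *)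
Lemma uext_uint (Q : nat) (s w : 'I_Q -> R) (u : pw_fun M) K j q :
  gauss_rule s w -> exists q',
  uext s u K j q = uint s u (nbr K j).1 (nbr K j).2 q'.
Proof.
move=> /gauss_nodes_symmetric /(_ q)[q' sq']; exists q'.
rewrite /uext /uint; congr (u _ _); rewrite /qpoint sq'.
have [-> ->] := nbr_translate K j.
by apply/eqP; rewrite /eq_op /= /GRing.scale /=; apply/andP; split; apply/eqP; ring.
Qed.

End Mesh.

(** L >= 3, so omega1 <= 1 / 6. *)
Lemma omega1_bounds (R : realType) (k : nat) : (2 <= k)%N ->
  0 <= omega1 R k /\ 0 < 1 - 2 * omega1 R k.
Proof.
move=> k2; have : (3 <= nquad k)%N by rewrite /nquad; lia.
rewrite -(ler_nat R) /omega1; set L := (nquad k)%:R => L3.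
have L6 : 6 <= L * (L - 1) by have := @ler_pM R 3 L 2 (L - 1); lra.
split; first by rewrite divr_ge0 //; lra.
rewrite subr_gt0 mulrA mulr1 ltr_pdivrMr; lra.
Qed.

Theorem theorem3p1 (R : realType) (Gam : R) (M : mesh R) (k Q : nat)
    (s w : 'I_Q -> R) (u : pw_fun M) (dt : R)
    (hGam : 1 < Gam <= 2)
    (hk : (2 <= k)%N)
    (hQ : (k <= 2 * Q - 1)%N)
    (hgauss : gauss_rule s w)
    (hu : Gh Gam s w k u)
    (hdt : 0 < dt)
    (hCFL : forall (K : cell M) (j : 'I_3),
       dt * sigmaK Gam s u K j * (edge_len K j / area K) <= 2 / 3 * omega1 R k) :
  forall K : cell M, Gu Gam (avg u K + dt *: LK Gam s w u K).
Proof.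
move=> K; case: hu => _ hu.
have [_ Gint GPi] := hu K.
have Gext j q : Gu Gam (uext s u K j q).
  have [q' ->] := uext_uint _ _ _ _ w u K j q hgauss.
  by have [_ + _] := hu (nbr K j).1.
have [om0 om2] := omega1_bounds R k hk.
set om := omega1 R k in hCFL GPi om0 om2.
have [_ _ w0 _] := hgauss.
pose b j := dt * (edge_len K j / area K).
have b0 j : 0 <= b j.
  by rewrite mulr_ge0 ?(ltW hdt) // divr_ge0 ?area_ge0 // sqrtr_ge0.
set Pi := (_ *: _) in GPi.
have -> : avg u K + dt *: LK Gam s w u K = (1 - 2 * om) *: Pi +
  \sum_(j < 3) \sum_(q < Q) w q *: ((2 / 3 * om) *: uint s u K j q
    - b j *: hll Gam (uint s u K j q) (uext s u K j q) (normal K j)).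
  rewrite /Pi scalerA divff ?scale1r ?gt_eqF //.
  rewrite /LK scalerN scalerA !scaler_sumr -!addrA; congr (_ + _).
  rewrite -!sumrN -big_split /=; apply: eq_bigr => j _.
  rewrite !scalerA !scaler_sumr -!sumrN -big_split /=; apply: eq_bigr => q _.
  by apply/rowP => i; rewrite !mxE /b; ring.
apply: open_cone_Gu => //; apply: open_closed_add.
  by apply: open_cone_scale => //; exact: (Gu_open_cone _ Gam).
apply: closed_cone_sum => j; apply: closed_cone_sum => q.
apply: closed_cone_scale; first exact/ltW.
have a0 : 0 <= 2 / 3 * om by lra.
(* A zero edge vector has no unit normal, but then the flux has coefficient 0. *)
have [e0|e0] := eqVneq (edge_len K j) 0.
  rewrite /b e0 mul0r mulr0 scale0r subr0; apply: closed_cone_scale => //.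
  exact/open_coneW/(Gu_open_cone _ Gam).
apply: hll_closed_cone => //; first exact: dot_normal.
apply: le_trans (hCFL K j); rewrite [leRHS]mulrAC -/(b j).
apply: ler_wpM2l => //.
have sint : sigma_hat Gam (uint s u K j q) (normal K j) <= sigmaK Gam s u K j.
  by rewrite /sigmaK (bigD1 q) //= !le_max lexx.
have sext : sigma_hat Gam (uext s u K j q) (normal K j) <= sigmaK Gam s u K j.
  by rewrite /sigmaK (bigD1 q) //= !le_max lexx orbT.
have s0 : 0 <= sigmaK Gam s u K j.
  exact: bigmax_ge_id.
rewrite /sigma_r !ge_max s0 andbT.
by apply/andP; split; [apply: le_trans sint|apply: le_trans sext];
  exact: lambda4_le_sigma_hat.
Qed.
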